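(* Suppose that $\varphi$ is strictly convex and twice differentiable on its domain, thrice differentiable at $1$, with $\varphi''(1)>0$, and that $$\frac{27\,\varphi''(1)}{\big(3-z\,\varphi'''(1)/\varphi''(1)\big)^3}\le\varphi''(1+z)$$ for all $z\ge-1$ (with $1+z$ in the interior of $\operatorname{dom}\varphi$). Then $\operatorname{hgt}_{\psi^\star}(t)\le\dfrac{t^2}{8\varphi''(1)}$ for all $t\ge0$; equivalently, for such $\varphi$, $$D_\varphi(\mu\|\nu)\ge\frac{\varphi''(1)}{2}\,\mathrm{TV}(\mu,\nu)^2\qquad\text{for all }\mu,\nu\in\mathcal M^1.$$
   Context: $(\Omega,\mathcal F)$ is a measurable space with $\{\emptyset,\Omega\}\subsetneq\mathcal F$; $\mathcal M^1$ is the set of probability measures on it. $\mathrm{TV}(\mu,\nu)=\sup\{|\int g\,d\mu-\int g\,d\nu|: g:\Omega\to[-1,1]\text{ measurable}\}$ (values in $[0,2]$). Standing assumptions on $\varphi$: $\varphi:\mathbb R\to[0,+\infty]$ is convex, lower semicontinuous, $\varphi(1)=0$, $\varphi(x)=+\infty$ for $x<0$, and $\operatorname{dom}\varphi=\{\varphi<\infty\}$ contains a neighborhood of $1$. Differentiability of $\varphi$ on its domain is understood on the interior of $\operatorname{dom}\varphi$. $\varphi'(\infty)=\lim_{x\to\infty}\varphi(x)/x$. Set $\psi(x)=\varphi(x+1)$, $\psi^\star(y)=\sup_x\{xy-\psi(x)\}$. For probability measures with Lebesgue decomposition $\mu=\mu_c+\mu_s$ ($\mu_c\ll\nu$, $\mu_s\perp\nu$),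 $D_\varphi(\mu\|\nu)=\int\varphi(\frac{d\mu_c}{d\nu})d\nu+\mu_s(\Omega)\varphi'(\infty)$, with $0\cdot\infty=0$. Height-for-width function: $\operatorname{hgt}_{\psi^\star}(w)=\inf\{h\in[0,\infty]:\text{the Lebesgue measure of }\{x\in\mathbb R:\psi^\star(x)\le h\}\text{ is at least }w\}$ for $w\ge0$. *)

(* Defs.v *)
From HB Require Import structures.
From mathcomp Require Import all_boot all_order all_algebra.
From mathcomp Require Import all_classical all_reals all_analysis.

Set Implicit Arguments.
Unset Strict Implicit.
Unset Printing Implicit Defensive.

Import Order.TTheory GRing.Theory Num.Theory.
Import numFieldNormedType.Exports.

Local Open Scope classical_set_scope.
Local Open Scope ring_scope.
Local Open Scope charge_scope.

Section extended_real_functions.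
Context {R : realType}.
Implicit Types phi psi : R -> \bar R.

Definition edom phi : set R := [set x | (phi x < +oo)%E].

Definition econvex phi := forall (t x y : R), 0 <= t <= 1 ->
  (phi (t * x + (1 - t) * y)%R <= t%:E * phi x + (1 - t)%R%:E * phi y)%E.

Definition strictly_econvex phi := forall (t x y : R), 0 < t < 1 ->
  edom phi x -> edom phi y -> x != y ->
  (phi (t * x + (1 - t) * y)%R < t%:E * phi x + (1 - t)%R%:E * phi y)%E.

(* The n-th derivative of phi, meaningful on the interior of edom phi: there
   phi >= 0 is finite near every point, so fine loses nothing. *)
Definition phi_deriv phi (n : nat) : R -> R := derive1n n (fine \o phi).

(* phi'(oo); the limit exists in \bar R whenever phi >= 0 is convex with
   phi 1 = 0. *)
Definition recession phi : \bar R :=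
  lim ((phi x * (x^-1)%:E)%E @[x --> +oo%R]).

Definition shift1 phi : R -> \bar R := fun x => phi (x + 1).

Definition conjugate psi (y : R) : \bar R :=
  ereal_sup (range (fun x : R => ((x * y)%R%:E - psi x)%E)).

Definition hgt (f : R -> \bar R) (w : R) : \bar R :=
  ereal_inf [set h : \bar R | (0 <= h)%E /\
    (w%:E <= lebesgue_measure [set x : R | (f x <= h)%E])%E].

End extended_real_functions.

Section measures.
Context {d : measure_display} {T : measurableType d} {R : realType}.

(* Values in [0, 2]: no factor 1/2. *)
Definition total_variation_distance (mu nu : {measure set T -> \bar R}) : \bar R :=
  ereal_sup [set `| \int[mu]_x (g x)%:E - \int[nu]_x (g x)%:E |%E
            | g in [set g : T -> R | measurable_fun setT g /\
                                     forall x, -1 <= g x <= 1]].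

Definition lebesgue_decomposition
    (mu nu muc mus : {measure set T -> \bar R}) : Prop :=
  [/\ forall A, measurable A -> mu A = (muc A + mus A)%E,
      muc `<< nu &
      exists N, [/\ measurable N, nu N = 0%E & mus (~` N) = 0%E]].

(* Proved here so that the two parts of the decomposition can be chosen without
   a default value. *)
Lemma lebesgue_decomposition_ex (mu nu : {finite_measure set T -> \bar R}) :
  exists p : {finite_measure set T -> \bar R} *
             {finite_measure set T -> \bar R},
    lebesgue_decomposition mu nu p.1 p.2.
Proof.
pose E := [set mu N | N in [set N | measurable N /\ nu N = 0%E]].
have E0 : E 0%E by exists set0; rewrite ?measure0.
have s_ge0 : (0 <= ereal_sup E)%E by exact: ereal_sup_ubound.
have s_fin : ereal_sup E \is a fin_num.
  rewrite ge0_fin_numE//; apply: (@le_lt_trans _ _ (mu setT)).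
    by apply: ge_ereal_sup => _ [N [mN _] <-]; apply: le_measure; rewrite ?inE.
  by rewrite ltey_eq fin_num_measure.
have /choice[F FP] : forall n : nat, exists N : set T,
    [/\ measurable N, nu N = 0%E & (ereal_sup E - n.+1%:R^-1%:E < mu N)%E].
  move=> n; have n0 : 0 < n.+1%:R^-1 :> R by rewrite invr_gt0.
  have [_ [N [mN nuN] <-] ?] := ub_ereal_sup_adherent n0 s_fin.
  by exists N.
pose N := \bigcup_n F n.
have mN : measurable N by apply: bigcup_measurable => n _; case: (FP n).
have nuN : nu N = 0%E.
  apply/eqP; rewrite -measure_le0.
  have mF n : measurable (F n) by case: (FP n).
  have := @measure_sigma_subadditive _ _ _ nu N F mF mN (fun=> id).
  move/le_trans; apply.
  by rewrite eseries0// => n _ _ /=; case: (FP n).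
have muN : (ereal_sup E <= mu N)%E.
  apply/lee_addgt0Pr => e e0.
  have [n ne] : exists n : nat, n.+1%:R^-1 < e.
    by have [n _ /(_ n)] := near_infty_natSinv_lt (PosNum e0) => /(_ (leqnn n)); exists n.
  have [mF _ /ltW muF] := FP n.
  rewrite -leeBlDr//.
  apply: (@le_trans _ _ (ereal_sup E - n.+1%:R^-1%:E)%E).
    by rewrite leeB// lee_fin ltW.
  apply: (le_trans muF); apply: le_measure; rewrite ?inE//.
  exact: bigcup_sup.
have mNC : measurable (~` N) by exact: measurableC.
exists (mrestr mu mNC : {finite_measure set T -> \bar R},
        mrestr mu mN : {finite_measure set T -> \bar R}); split => /=.
- move=> A mA; rewrite /mrestr -measureU.
  + by rewrite -setIUr setUC setUv setIT.
  + exact: measurableI.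
  + exact: measurableI.
  + by rewrite setIACA setICl setI0.
- apply/null_content_dominatesP => A mA nuA; rewrite /= /mrestr.
  have mAN : measurable (A `&` ~` N) by exact: measurableI.
  have nuAN : nu (A `&` ~` N) = 0%E.
    by apply: (@subset_measure0 _ _ _ _ _ A).
  have dj : (A `&` ~` N) `&` N = set0 by rewrite -setIA setICl setI0.
  have : (mu ((A `&` ~` N) `|` N) <= ereal_sup E)%E.
    apply: ereal_sup_ubound; exists ((A `&` ~` N) `|` N) => //; split.
      exact: measurableU.
    by rewrite measureU// -[RHS]adde0; congr adde.
  rewrite measureU// => /le_trans/(_ muN).
  rewrite -[leRHS]add0e leeD2rE ?fin_num_measure// measure_le0.
  by move/eqP.
- by exists N; split=> //; rewrite /mrestr setICl measure0.
Qed.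


Definition ac_part (mu nu : {finite_measure set T -> \bar R}) :
    {finite_measure set T -> \bar R} :=
  (sval (cid (lebesgue_decomposition_ex mu nu))).1.

Definition sing_part (mu nu : {finite_measure set T -> \bar R}) :
    {finite_measure set T -> \bar R} :=
  (sval (cid (lebesgue_decomposition_ex mu nu))).2.

(* The Radon-Nikodym derivative is finite everywhere since ac_part mu nu is
   finite and dominated by nu; 0 * +oo = 0 in \bar R, as required. *)
Definition phi_divergence (phi : R -> \bar R) (mu nu : probability T R) :
    \bar R :=
  (\int[nu]_x phi (fine ('d (charge_of_finite_measure (ac_part mu nu)) '/d nu x))
   + sing_part mu nu setT * recession phi)%E.

End measures.

(* Main.v *)
(** With [a = phi''(1)], [b = phi'''(1)], [k = b / (3 a)] the hypothesis reads
    [a / (1 - k z)^3 <= phi''(1 + z)]; its left-hand side is the second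
    derivative of [F z = a z^2 / (2 (1 - k z))], and [F], [phi (1 + _)] and
    their first derivatives vanish at [0], so [phi (1 + z) >= F z].  By AM-GM,
    for every real [s],
      [phi (1 + z) >= (a / 2) (2 s |z| - s^2 (1 - k z))],
    where the right-hand side is affine in [(|z|, z)].  Taking [s = t / (2 a)],
    conjugation yields an interval of length [t] on which
    [psi^* <= t^2 / (8 a)].  Taking [s = TV(mu, nu)] and integrating against
    [nu] yields the Pinsker inequality: the singular part of [mu] is charged the
    slope [(a / 2) (2 s + s^2 k)] of the minorant, and the terms in [k] cancel
    because [mu] and [nu] have the same mass. *)
Require Import Defs.
From HB Require Import structures.
From mathcomp Require Import all_boot all_order all_algebra.
From mathcomp Require Import all_classical all_reals all_analysis.
From mathcomp Require Import measurable_realfun ring lra.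

Import Order.TTheory GRing.Theory Num.Theory.
Import numFieldNormedType.Exports.

Local Open Scope classical_set_scope.
Local Open Scope ring_scope.

(** * Lower bounds for [phi] from the second-derivative inequality *)

(** The homothety of ratio [1 - t] centred at [x] carries the ball of radius [e] about [c] onto one
    of radius [(1 - t) * e], which convexity keeps inside the domain. *)
Lemma edom_interior_segment (R : realType) (phi : R -> \bar R) (c x t : R) :
  econvex phi -> (edom phi)° c -> edom phi x -> 0 <= t < 1 ->
  (edom phi)° (t * x + (1 - t) * c).
Proof.
move=> cvx /nbhs_ballP[e /= e0 ce] phix /andP[t0 t1].
have u0 : 0 < 1 - t by rewrite subr_gt0.
apply/nbhs_ballP; exists ((1 - t) * e); first by rewrite /= mulr_gt0.
move=> w; rewrite /ball/= => cw.
pose y := (w - t * x) / (1 - t).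
have -> : w = t * x + (1 - t) * y by rewrite /y; field; rewrite gt_eqF.
have phiy : (phi y < +oo)%E.
  apply: ce; rewrite /ball/=.
  have -> : c - y = (t * x + (1 - t) * c - w) / (1 - t).
    by rewrite /y; field; rewrite gt_eqF.
  by rewrite normrM normfV (gtr0_norm u0) ltr_pdivrMr 1?(mulrC e).
rewrite /edom/=; apply: (le_lt_trans (cvx t x y _)); first by rewrite t0 ltW.
by rewrite lte_add_pinfty// lte_mul_pinfty// lee_fin ltW.
Qed.

(** Two uses of the mean value theorem give [g 1 = g1 c] and [g1 c = g2 d * c] with
    [0 <= d <= c <= 1]. *)
Lemma ge0_of_second_derive_ge0 (R : realType) (g g1 g2 : R -> R) :
  (forall t : R, t \in `[0, 1] -> is_derive t 1 g (g1 t)) ->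
  (forall t : R, t \in `[0, 1] -> is_derive t 1 g1 (g2 t)) ->
  (forall t : R, t \in `[0, 1] -> 0 <= g2 t) ->
  g 0 = 0 -> g1 0 = 0 -> 0 <= g 1.
Proof.
move=> dg dg1 g2_ge0 g0 g10.
have mvt (f df : R -> R) (b : R) : b \in `[0, 1] ->
    (forall t : R, t \in `[0, 1] -> is_derive t 1 f (df t)) -> f 0 = 0 ->
    exists2 c, c \in `[0, b] & f b = df c * b.
  rewrite in_itv/= => /andP[b0 b1] dfE f0.
  have sub x : x \in `[0, b] -> x \in `[0, 1].
    by rewrite !in_itv/= => /andP[-> /le_trans->].
  have df_oo x : x \in `]0, b[ -> is_derive x 1 f (df x).
    by move=> xb; apply/dfE/sub; exact: subset_itv_oo_cc xb.
  have cf : {within `[0, b], continuous f}.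
    apply: derivable_within_continuous => x /sub /dfE dfx.
    exact: ex_derive.
  have [c cb] := MVT_segment b0 df_oo cf.
  by rewrite f0 !subr0 => ->; exists c.
have i01 : 1 \in `[(0 : R), 1] by rewrite bound_itvE ler01.
have [c c01 ->] := mvt g g1 1 i01 dg g0.
have [d dc ->] := mvt g1 g2 c c01 dg1 g10.
have d01 : d \in `[0, 1].
  move: c01 dc; rewrite !in_itv/= => /andP[_ c1] /andP[-> dc].
  exact: le_trans c1.
move: c01; rewrite in_itv/= => /andP[c0 _].
by rewrite mulr1 mulr_ge0// g2_ge0.
Qed.

Lemma is_derive_comp_affine (R : realType) (f : R -> R) (c z t df : R) :
  is_derive (c + t * z) 1 f df ->
  is_derive t 1 (fun s : R => f (c + s * z)) (df * z).
Proof.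
move=> dfE; apply: (@is_derive1_comp _ f (fun s => c + s * z)).
by apply: is_derive_eq; rewrite add0r mul1r scaler0 add0r [LHS]mulr1.
Qed.

Lemma is_derive_pearson (R : realType) (k x : R) : 1 - k * x != 0 ->
  is_derive x 1 (fun y : R => y ^+ 2 / (1 - k * y))
    ((2 * x - k * x ^+ 2) / (1 - k * x) ^+ 2).
Proof.
move=> kx; apply: is_derive_eq.
rewrite /GRing.scale/=.
by field.
Qed.

(** Over the denominator [(1 - k x)^3] the numerator collapses: [(2 - 2 k x) (1 - k x) + 2 k (2 x -
    k x^2) = 2]. *)
Lemma is_derive2_pearson (R : realType) (k x : R) : 1 - k * x != 0 ->
  is_derive x 1 (fun y : R => (2 * y - k * y ^+ 2) / (1 - k * y) ^+ 2)
    (2 / (1 - k * x) ^+ 3).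
Proof.
move=> kx; have kx2 : (1 - k * x) ^+ 2 != 0 by rewrite expf_neq0.
apply: is_derive_eq.
rewrite /GRing.scale/=.
by field.
Qed.

Lemma is_derive_mulr (R : realType) (f : R -> R) (z t df : R) :
  is_derive t 1 f df -> is_derive t 1 (fun s : R => f s * z) (df * z).
Proof.
move=> dfE; apply: is_derive_eq.
by rewrite scaler0 add0r /GRing.scale/= mulrC.
Qed.

(** The comparison runs along the segment from [1] to [1 + z]: both side conditions at [z] persist
    at every [t * z] with [t] in [[0, 1]], so the problem becomes one of a single real variable
    [t]. *)
Lemma fine_ge_pearson (R : realType) (phi : R -> \bar R) (a k z : R) :
  (forall x, (0 <= phi x)%E) -> econvex phi -> phi 1 = 0%E ->
  (edom phi)° 1 ->
  (forall x, (edom phi)° x ->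
     derivable (phi_deriv phi 0) x 1 /\ derivable (phi_deriv phi 1) x 1) ->
  (forall y, (edom phi)° (1 + y) -> 0 < 1 - k * y ->
     a / (1 - k * y) ^+ 3 <= phi_deriv phi 2 (1 + y)) ->
  (edom phi)° (1 + z) -> 0 < 1 - k * z ->
  a * z ^+ 2 / (2 * (1 - k * z)) <= fine (phi (1 + z)).
Proof.
move=> phi_ge0 cvx phi1 dom1 dphi lb domz kz.
have seg t : t \in `[0, 1] -> (edom phi)° (1 + t * z).
  rewrite in_itv/= => /andP[t0]; rewrite le_eqVlt => /predU1P[->|t1].
    by rewrite mul1r.
  have -> : 1 + t * z = t * (1 + z) + (1 - t) * 1 by ring.
  by apply: edom_interior_segment; rewrite ?t0//; exact: interior_subset domz.
have kt t : t \in `[0, 1] -> 0 < 1 - k * (t * z).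
  rewrite in_itv/= => /andP[t0]; rewrite le_eqVlt => /predU1P[->|t1].
    by rewrite mul1r.
  have -> : 1 - k * (t * z) = t * (1 - k * z) + (1 - t) by ring.
  by rewrite ltr_wpDl ?subr_gt0// mulr_ge0// ltW.
(* The point [1] minimises [phi] and is interior to the domain, so the derivative vanishes there. *)
have dphi1 : is_derive (1 : R) 1 (phi_deriv phi 0) 0.
  move/nbhs_ballP: (dom1) => [e /= e0 e1].
  have near1 x : x \in `]1 - e, 1 + e[ -> ball (1 : R) e x.
    by rewrite in_itv/= /ball/= => /andP[? ?]; rewrite ltr_norml; lra.
  have e1' : ball (1 : R) e `<=` (edom phi)°.
    by rewrite -open_subsetE//; exact: ball_open.
  apply: (@derive1_at_min _ _ (1 - e) (1 + e)).
  - lra.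
  - by move=> x /near1 /e1' /dphi[].
  - by rewrite in_itv/=; lra.
  - by move=> x _; rewrite /phi_deriv/= phi1 fine_ge0.
pose dg n := phi_deriv phi n.
have dgE n x : derivable (dg n) x 1 -> is_derive x 1 (dg n) (dg n.+1 x).
  by move/derivableP; rewrite /dg /phi_deriv derive1nS derive1E.
pose F x := x ^+ 2 / (1 - k * x).
pose F1 x := (2 * x - k * x ^+ 2) / (1 - k * x) ^+ 2.
pose F2 x := 2 / (1 - k * x) ^+ 3.
suff : 0 <= dg 0 (1 + 1 * z) - a / 2 * F (0 + 1 * z).
  rewrite subr_ge0 mul1r add0r; congr (_ <= _).
  by rewrite /F; field; rewrite gt_eqF.
pose g t := dg 0%N (1 + t * z) - a / 2 * F (0 + t * z).
pose g1 t := dg 1%N (1 + t * z) * z - a / 2 * (F1 (0 + t * z) * z).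
pose g2 t := dg 2%N (1 + t * z) * z * z - a / 2 * (F2 (0 + t * z) * z * z).
apply: (@ge0_of_second_derive_ge0 _ g g1 g2).
- move=> t t01; apply: is_deriveB.
    apply: is_derive_comp_affine; apply: dgE.
    exact: (dphi _ (seg _ t01)).1.
  apply: is_deriveZ; apply: is_derive_comp_affine; apply: is_derive_pearson.
  by rewrite add0r gt_eqF// kt.
- move=> t t01; apply: is_deriveB.
    apply: is_derive_mulr; apply: is_derive_comp_affine; apply: dgE.
    exact: (dphi _ (seg _ t01)).2.
  apply: is_deriveZ; apply: is_derive_mulr; apply: is_derive_comp_affine.
  apply: is_derive2_pearson.
  by rewrite add0r gt_eqF// kt.
- move=> t t01; rewrite /g2 add0r /F2.
  have := lb _ (seg _ t01) (kt _ t01); rewrite -/(dg 2%N) => h.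
  have -> : dg 2%N (1 + t * z) * z * z
      - a / 2 * (2 / (1 - k * (t * z)) ^+ 3 * z * z)
    = (dg 2%N (1 + t * z) - a / (1 - k * (t * z)) ^+ 3) * z ^+ 2.
    by field; rewrite gt_eqF// kt.
  by rewrite mulr_ge0 ?sqr_ge0// subr_ge0.
- rewrite /g /dg /phi_deriv/= !mul0r !addr0 phi1 /F expr0n/=.
  by rewrite mul0r mulr0 subr0.
- rewrite /g1 !mul0r !addr0 /F1.
  have -> : dg 1%N 1 = 0.
    by rewrite /dg /phi_deriv derive1n1 derive1E; apply: derive_val.
  by ring.
Qed.

Lemma ler_of_scaled_lt1 (R : realFieldType) (c d : R) :
  0 <= d -> (forall t, 0 < t < 1 -> c * t <= d) -> c <= d.
Proof.
move=> d0 h; rewrite leNgt; apply/negP => dc.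
have c0 : 0 < c by exact: le_lt_trans dc.
(* This [t] makes [c * t] the midpoint of [d] and [c], hence larger than [d]. *)
have := h ((c + d) / (2 * c)).
have -> : c * ((c + d) / (2 * c)) = (c + d) / 2 by field; rewrite gt_eqF.
rewrite divr_gt0 ?ltr_pdivrMr/=; [|lra..].
by move=> /(_ ltac:(lra)); lra.
Qed.

(** The bound by [F] is known at interior points [1 + t z], [t < 1]; convexity in the form
    [phi (1 + t z) <= t phi (1 + z)] transfers it to [1 + z], which may lie on the boundary of the
    domain. *)
Lemma phi_ge_tangent (R : realType) (phi : R -> \bar R) (a k s z : R) :
  (forall x, (0 <= phi x)%E) -> econvex phi -> phi 1 = 0%E ->
  (edom phi)° 1 ->
  (forall x, (edom phi)° x ->
     derivable (phi_deriv phi 0) x 1 /\ derivable (phi_deriv phi 1) x 1) ->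
  0 < a ->
  (forall y, (edom phi)° (1 + y) -> 0 < 1 - k * y ->
     a / (1 - k * y) ^+ 3 <= phi_deriv phi 2 (1 + y)) ->
  ((a / 2 * (2 * s * `|z| - s ^+ 2 * (1 - k * z)))%:E <= phi (1 + z)%R)%E.
Proof.
move=> phi_ge0 cvx phi1 dom1 dphi a0 lb.
have [domz|] := boolP (phi (1 + z)%R < +oo)%E; last first.
  by rewrite -leNgt leye_eq => /eqP->; rewrite leey.
have phiE x : (phi x < +oo)%E -> (fine (phi x))%:E = phi x.
  by move=> ?; rewrite fineK// ge0_fin_numE.
set g := fine (phi (1 + z)).
have g0 : 0 <= g by rewrite fine_ge0.
have ray t : 0 < t < 1 -> 0 < 1 - k * (t * z) ->
    a * t * z ^+ 2 <= 2 * g * (1 - k * (t * z)).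
  move=> /andP[t0 t1] kt.
  have E : 1 + t * z = t * (1 + z) + (1 - t) * 1 by ring.
  have domt : (edom phi)° (1 + t * z).
    by rewrite E; apply: edom_interior_segment; rewrite ?(ltW t0).
  have h := @fine_ge_pearson _ _ _ _ _ phi_ge0 cvx phi1 dom1 dphi lb domt kt.
  have : fine (phi (1 + t * z)) <= t * g.
    rewrite -lee_fin EFinM !phiE//; last exact: (interior_subset domt).
    rewrite E; apply: (le_trans (cvx t (1 + z) 1 _)); first by rewrite !ltW.
    by rewrite phi1 mule0 adde0.
  move/(le_trans h); rewrite ler_pdivrMr ?mulr_gt0// => h'.
  by rewrite -(ler_pM2l t0); move: h'; congr (_ <= _); ring.
(* Otherwise [1 - k t z] vanishes for some [0 < t <= 1], where the lower bound
   of [ray] on [phi (1 + z)] blows up. *)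
have kz : 0 < 1 - k * z.
  rewrite ltNge; apply/negP => kz.
  have kz1 : 1 <= k * z by lra.
  have z2 : 0 < a * z ^+ 2.
    rewrite mulr_gt0// exprn_even_gt0//=; apply/negP => /eqP z0.
    by move: kz1; rewrite z0 mulr0; lra.
  pose M := 2 * g * (k * z).
  have M0 : 0 <= M by apply: mulr_ge0; lra.
  (* At the [t] with [1 - k t z = e], [ray] reads [a z^2 (1 - e) <= e M], that is
     [a z^2 <= e (M + a z^2)]; this [e] makes the right-hand side [a z^2 / 2], which is absurd. *)
  pose e := a * z ^+ 2 / (2 * (M + a * z ^+ 2)).
  have Mz : 0 < M + a * z ^+ 2 by lra.
  have e0 : 0 < e by rewrite divr_gt0// mulr_gt0.
  have e1 : e <= 1 / 2.
    by rewrite /e ler_pdivrMr ?mulr_gt0//; lra.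
  pose t := (1 - e) / (k * z).
  have kz0 : 0 < k * z by lra.
  have kt : k * (t * z) = 1 - e.
    by rewrite mulrCA /t divfK// gt_eqF.
  have t01 : 0 < t < 1.
    by rewrite /t divr_gt0 ?ltr_pdivrMr; lra.
  have := ray t t01; rewrite kt => /(_ ltac:(lra)).
  rewrite (_ : 1 - (1 - e) = e); last by ring.
  rewrite (_ : a * t * z ^+ 2 = a * z ^+ 2 * (1 - e) / (k * z)); last first.
    by rewrite /t mulrAC !mulrA.
  rewrite ler_pdivrMr// => h.
  have : a * z ^+ 2 <= e * (M + a * z ^+ 2) by rewrite /M; nra.
  rewrite (_ : e * _ = a * z ^+ 2 / 2); first lra.
  by rewrite /e; field; rewrite gt_eqF.
(* The inequality in [ray] is affine in [t], so [t] can be sent to [1]. *)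
have bound : a * z ^+ 2 <= 2 * g * (1 - k * z).
  rewrite mulrBr mulr1 lerBrDr; apply: ler_of_scaled_lt1; first lra.
  move=> t t01; have := ray t t01; case/andP: t01 => t0 t1.
  move=> /(_ ltac:(nra)); lra.
rewrite -(phiE _ domz) lee_fin -/g -(ler_pM2r kz).
(* AM-GM as a square: after multiplication by [1 - k z], the gap between [a z^2 / 2] and the
   minorant is half of this quantity. *)
have : 0 <= a * (`|z| - s * (1 - k * z)) ^+ 2.
  by rewrite mulr_ge0 ?sqr_ge0// ltW.
rewrite sqrrB real_normK ?num_real//; lra.
Qed.

(** * Consequences of a minorant: recession slope and height of the conjugate *)

Lemma recession_ge_slope (R : realType) (phi : R -> \bar R) (L M : R) :
  (forall x, (0 <= phi x)%E) -> econvex phi -> phi 1 = 0%E ->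
  (forall x, 1 <= x -> ((L * x - M)%:E <= phi x)%E) ->
  (L%:E <= recession phi)%E.
Proof.
move=> phi_ge0 cvx phi1 lb.
(* On [1, +oo[, [phi x / x] is the product of the nondecreasing functions
   [phi x / (x - 1)] and [(x - 1) / x]; [Num.max x 1] makes it monotone on R. *)
pose f (x : R) := (phi (Num.max x 1)%R * ((Num.max x 1)^-1)%:E)%E.
have f_nd : {homo f : x y / (x <= y)%R >-> (x <= y)%E}.
  move=> x' y' xy'; rewrite /f.
  have xy : Num.max x' 1 <= Num.max y' 1.
    by rewrite ge_max !le_max xy' lexx !orbT.
  have x1 : 1 <= Num.max x' 1 by rewrite le_max lexx orbT.
  move: (Num.max x' 1) (Num.max y' 1) xy x1 => x y xy x1 {x' y' xy'}.
  have x0 : 0 < x by lra.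
  have y0 : 0 < y by lra.
  have [y1|y1] := leP y 1.
    have -> : x = 1 by lra.
    by have -> : y = 1 by lra.
  pose t := (x - 1) / (y - 1).
  have y10 : 0 < y - 1 by lra.
  have t0 : 0 <= t by rewrite divr_ge0//; lra.
  have t1 : t <= 1 by rewrite ler_pdivrMr//; lra.
  have := cvx t y 1; rewrite t0 t1 phi1 mule0 adde0 => /(_ isT).
  have -> : t * y + (1 - t) * 1 = x by rewrite /t; field; rewrite gt_eqF.
  move=> phix; rewrite lee_pdivrMr//.
  apply: (le_trans phix); rewrite -muleA muleC; apply: lee_wpmul2l => //.
  rewrite -EFinM lee_fin mulrC ler_pdivlMr// /t mulrAC ler_pdivrMr//; nra.
have -> : recession phi = ereal_sup (range f).
  apply: cvg_lim => //.
  apply: cvg_trans (nondecreasing_cvge f_nd).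
  apply: near_eq_cvg; near=> x.
  rewrite /f max_l//; near: x; exact: nbhs_pinfty_ge.
apply/lee_addgt0Pr => e e0.
(* Large enough that [M / x <= e], so that [phi x / x >= L - M / x >= L - e]. *)
pose x := Num.max 1 (`|M| / e).
have x1 : 1 <= x by rewrite le_max lexx.
have x0 : 0 < x by lra.
have Mx : M <= e * x.
  apply: (le_trans (ler_norm _)); rewrite mulrC -ler_pdivrMr//.
  by rewrite le_max lexx orbT.
apply: (@le_trans _ _ (f x + e%:E)%E); last first.
  by apply: leeD => //; apply: ereal_sup_ubound; exists x.
rewrite -leeBlDr// /f (max_l x1) lee_pdivlMr// -EFinB -EFinM.
by apply: le_trans (lb _ x1); rewrite lee_fin mulrBl; lra.
Unshelve. all: by end_near. Qed.

(** Conjugation reverses order, and the conjugate of the minorant equals [t^2 / (8 a)] on the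
    interval of length [t] centred at [c], because [(y - c) z <= (t / 2) |z|] there. *)
Lemma hgt_conjugate_le (R : realType) (psi : R -> \bar R) (a c t : R) :
  0 < a -> 0 <= t ->
  (forall z, ((c * z + t / 2 * `|z| - t ^+ 2 / (8 * a))%:E <= psi z)%E) ->
  (hgt (conjugate psi) t <= (t ^+ 2 / (8 * a))%:E)%E.
Proof.
move=> a0 t0 lb.
have h0 : 0 <= t ^+ 2 / (8 * a) by rewrite divr_ge0 ?sqr_ge0//; lra.
apply: ereal_inf_lbound; split; first by rewrite lee_fin.
have sub : `[c - t / 2, c + t / 2] `<=`
    [set y | (conjugate psi y <= (t ^+ 2 / (8 * a))%:E)%E].
  move=> y; rewrite /= in_itv/= => /andP[y1 y2].
  apply: ge_ereal_sup => _ [z _ <-].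
  move: (lb z); case: (psi z) => [r| |] //; rewrite ?leNye// -EFinB !lee_fin.
  have : (y - c) * z <= t / 2 * `|z|.
    apply: (le_trans (ler_norm _)); rewrite normrM ler_wpM2r// ler_norml.
    by lra.
  lra.
apply: (@le_trans _ _ (lebesgue_measure `[c - t / 2, c + t / 2])).
  rewrite lebesgue_measure_itv/= lte_fin; case: ifPn => ct.
    by rewrite -EFinB lee_fin; lra.
  by rewrite lee_fin; lra.
apply: le_measure => //; rewrite inE; first exact: measurable_itv.
(* The sublevel set is an interval: each function [y |-> z y - psi z] is monotone, so its value at
   [y] is at most its value at [y2] if [z >= 0], at [y1] otherwise. *)
apply: is_interval_measurable => y1 y2 /= y1h y2h y /andP[y1y yy2].
apply: ge_ereal_sup => _ [z _ <-].
have [z0|/ltW z0] := leP 0 z.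
  apply: le_trans y2h; apply: le_trans (ereal_sup_ubound _); last by exists z.
  by rewrite leeB// lee_fin ler_wpM2l.
apply: le_trans y1h; apply: le_trans (ereal_sup_ubound _); last by exists z.
by rewrite leeB// lee_fin ler_wnM2l.
Qed.

(** * Total variation and divergence through the Lebesgue decomposition *)

Lemma bounded_integrable (d : measure_display) (T : measurableType d)
    (R : realType) (mu : {finite_measure set T -> \bar R}) (g : T -> R) :
  measurable_fun setT g -> (forall x, -1 <= g x <= 1) ->
  mu.-integrable setT (EFin \o g).
Proof.
move=> mg g1; apply: measurable_bounded_integrable => //.
  by rewrite ltey_eq fin_num_measure.
exists 1; split => // M M1 x _ /=; apply: ltW; apply: le_lt_trans M1.
by rewrite ler_norml g1.
Qed.

Lemma abse_integral_le_mass (d : measure_display) (T : measurableType d)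
    (R : realType) (mu : {measure set T -> \bar R}) (g : T -> R) :
  measurable_fun setT g -> (forall x, -1 <= g x <= 1) ->
  (`|\int[mu]_x (g x)%:E| <= mu setT)%E.
Proof.
move=> mg g1; apply: (le_trans (le_abse_integral _ _ _)) => //.
  exact/measurable_EFinP.
apply: (@le_trans _ _ (\int[mu]_x (cst 1%E x))%E); last first.
  by rewrite integral_cst// mul1e.
apply: ge0_le_integral => //.
  by apply: measurableT_comp => //; exact/measurable_EFinP.
by move=> x _; rewrite lee_fin ler_norml.
Qed.

(** With [f] the density of [muc], the difference of the integrals of [g] is the [nu]-integral of
    [g (f - 1)] plus the [mus]-integral of [g], and [|g| <= 1]. *)
Lemma total_variation_distance_le (d : measure_display) (T : measurableType d)
    (R : realType) (mu nu muc mus : {finite_measure set T -> \bar R}) :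
  lebesgue_decomposition mu nu muc mus ->
  (total_variation_distance mu nu <=
   \int[nu]_x
     (`|fine (Radon_Nikodym (charge_of_finite_measure muc) nu x) - 1|)%:E
   + mus setT)%E.
Proof.
move=> [muE cnu _].
set f := Radon_Nikodym _ _.
have cnu' : charge_of_finite_measure muc `<< nu by exact: cnu.
have fE x : (fine (f x))%:E = f x by rewrite fineK// Radon_Nikodym_fin_num.
have fi : nu.-integrable setT f by exact: Radon_Nikodym_integrable.
apply: ge_ereal_sup => _ [g [mg g1] <-].
have gi (m : {finite_measure set T -> \bar R}) :
  m.-integrable setT (EFin \o g) by exact: bounded_integrable.
have -> : (\int[mu]_x (g x)%:E = \int[muc]_x (g x)%:E + \int[mus]_x (g x)%:E)%E.
  rewrite -integral_measure_add//.
  - apply: eq_measure_integral => A mA _; rewrite muE//.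
    exact: esym (measure_addE _ _ _).
  - exact: gi.
  - exact: gi.
have gfi : nu.-integrable setT (fun x => (g x)%:E * f x)%E.
  apply: (integrableMr _ mg) => //.
  exists 1; split => // M M1 x _ /=; apply: ltW; apply: le_lt_trans M1.
  by rewrite ler_norml g1.
have mf1 : measurable_fun setT (fun x => fine (f x) - 1).
  apply: measurable_funB => //.
  exact: measurableT_comp (measurable_int _ fi).
have -> : (\int[muc]_x (g x)%:E = \int[nu]_x ((g x)%:E * f x))%E.
  by apply/esym/Radon_Nikodym_change_of_variables => //; exact: gi.
rewrite addeAC.
have -> : (\int[nu]_x ((g x)%:E * f x) - \int[nu]_x (g x)%:E =
           \int[nu]_x ((g x)%:E * f x - (g x)%:E))%E.
  by apply/esym/integralB => //; exact: gi.
apply: (le_trans (lee_abs_add _ _)); apply: leeD.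
- apply: (le_trans (le_abse_integral _ _ _)) => //.
    apply: emeasurable_funB; first exact: measurable_int gfi.
    exact/measurable_EFinP.
  apply: ge0_le_integral => //.
  + apply: measurableT_comp => //.
    apply: emeasurable_funB; first exact: measurable_int gfi.
    exact/measurable_EFinP.
  + by apply/measurable_EFinP; apply: measurableT_comp.
  + move=> x _; rewrite -/f -fE -EFinM -EFinB -[X in _ - X]mulr1 -mulrBr.
    rewrite lee_fin normrM -[leRHS]mul1r ler_wpM2r// ler_norml.
    exact: g1.
- exact: abse_integral_le_mass.
Qed.

Lemma total_variation_distance_ge0 (d : measure_display)
    (T : measurableType d) (R : realType) (mu nu : {measure set T -> \bar R}) :
  (0 <= total_variation_distance mu nu)%E.
Proof.
apply: (@le_trans _ _ `|0 - 0|%E); first exact: abse_ge0.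
apply: ereal_sup_ubound; exists (cst 0).
  by split=> // x; rewrite lerN10 ler01.
by rewrite !integral0.
Qed.

Lemma total_variation_distance_fin_num (d : measure_display)
    (T : measurableType d) (R : realType)
    (mu nu : {finite_measure set T -> \bar R}) :
  total_variation_distance mu nu \is a fin_num.
Proof.
rewrite ge0_fin_numE.
  apply: (@le_lt_trans _ _ (mu setT + nu setT)%E); last first.
    by rewrite lte_add_pinfty// ltey_eq fin_num_measure.
  apply: ge_ereal_sup => _ [g [mg g1] <-].
  apply: (le_trans (lee_abs_sub _ _)).
  by apply: leeD; exact: abse_integral_le_mass.
exact: total_variation_distance_ge0.
Qed.

(** Let [A] be the integral of [|f - 1|] and [m] the singular mass. Since [f - 1] integrates to
    [- m], the minorant integrates to [c1 A - c2 m + c3]; the singular term adds at least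
    [m (c1 + c2)], leaving [c1 (A + m) + c3]. *)
Lemma phi_divergence_ge (d : measure_display) (T : measurableType d)
    (R : realType) (phi : R -> \bar R) (c1 c2 c3 : R)
    (mu nu : probability T R) :
  measurable_fun setT phi -> (forall x, (0 <= phi x)%E) -> 0 <= c1 ->
  (forall x, ((c1 * `|x - 1| + c2 * (x - 1) + c3)%:E <= phi x)%E) ->
  ((c1 + c2)%:E <= recession phi)%E ->
  (c1%:E * total_variation_distance mu nu + c3%:E
   <= phi_divergence phi mu nu)%E.
Proof.
move=> mphi phi_ge0 c10 lb rec.
have dec : lebesgue_decomposition mu nu (ac_part mu nu) (sing_part mu nu).
  exact: (svalP (cid (lebesgue_decomposition_ex mu nu))).
have tv := @total_variation_distance_le _ _ _ _ _ _ _ dec.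
move: dec tv; rewrite /phi_divergence.
move: (ac_part mu nu) (sing_part mu nu) => muc mus [muE cnu _].
set f := fun x => fine (Radon_Nikodym (charge_of_finite_measure muc) nu x).
move=> tv.
have cnu' : charge_of_finite_measure muc `<< nu by exact: cnu.
have fE : EFin \o f = Radon_Nikodym (charge_of_finite_measure muc) nu.
  by apply/funext => x; rewrite /= fineK// Radon_Nikodym_fin_num.
have fi : nu.-integrable setT (EFin \o f).
  by rewrite fE; exact: Radon_Nikodym_integrable.
have mf : measurable_fun setT f.
  by apply/measurable_EFinP; exact: measurable_int fi.
pose m := fine (mus setT).
have mE : (m%:E = mus setT)%E by rewrite fineK// fin_num_measure.
have m0 : 0 <= m by rewrite fine_ge0.
have intf : (\int[nu]_x (f x)%:E = (1 - m)%:E)%E.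
  transitivity (muc setT).
    by rewrite [RHS](Radon_Nikodym_integral cnu')// -fE.
  have muT : (1 = muc setT + mus setT)%E.
    by rewrite -[LHS](probability_setT mu); exact: muE.
  by rewrite EFinB muT -mE addeK.
have fi1 : nu.-integrable setT (EFin \o (fun x => f x - 1)).
  exact: (integrableB _ fi (finite_measure_integrable_cst nu 1 _)).
have icst r : (\int[nu]_x cst r%:E x = r%:E)%E.
  rewrite integral_cst// -[RHS]mule1; congr (_ * _)%E.
  exact: probability_setT.
have intf1 : (\int[nu]_x (f x - 1)%:E = (- m)%:E)%E.
  transitivity (\int[nu]_x ((f x)%:E - (cst 1%E x)))%E; first by [].
  rewrite integralB//; last exact: finite_measure_integrable_cst.
  by rewrite intf icst -EFinB; congr (_%:E); ring.
have afi : nu.-integrable setT (EFin \o (fun x => `|f x - 1|)).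
  exact: integrable_abse fi1.
pose A := fine (\int[nu]_x `|f x - 1|%:E)%E.
have AE : (A%:E = \int[nu]_x `|f x - 1|%:E)%E.
  by rewrite fineK//; exact: integrable_fin_num afi.
pose h x := c1 * `|f x - 1| + c2 * (f x - 1) + c3.
have i1 := integrableZl measurableT c1 afi.
have i2 := integrableZl measurableT c2 fi1.
have i3 := finite_measure_integrable_cst nu c3 measurableT.
have i12 := integrableD measurableT i1 i2.
have hi : nu.-integrable setT (EFin \o h) by exact: (integrableD _ i12 i3).
have hE : (\int[nu]_x (h x)%:E = (c1 * A - c2 * m + c3)%:E)%E.
  transitivity (\int[nu]_x (c1%:E * (`|f x - 1|)%:E + c2%:E * (f x - 1)%:E
                            + cst c3%:E x))%E; first by [].
  rewrite (integralD _ i12 i3)// (integralD _ i1 i2)//.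
  rewrite (integralZl _ afi)// (integralZl _ fi1)// icst intf1.
  rewrite -AE -!EFinM -!EFinD.
  by congr (_%:E); ring.
have hphi : (\int[nu]_x (h x)%:E <= \int[nu]_x phi (f x))%E.
  (* The integral of [phi] may be infinite and [h] may be negative; the positive part of [h] still
     lies below [phi], and monotonicity for nonnegative functions applies to it. *)
  apply: (@le_trans _ _ (\int[nu]_x ((EFin \o h)^\+%E x))%E).
    apply: le_integral => //; first exact: integrable_funepos.
    by move=> x _; rewrite funeposE le_max lexx.
  apply: ge0_le_integral => //.
  - by apply: measurable_int; exact: integrable_funepos hi.
  - exact: measurableT_comp mphi mf.
  - by move=> x _; rewrite funeposE ge_max phi_ge0 andbT; exact: lb.
apply: (@le_trans _ _ ((c1 * (A + m) + c3)%:E)).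
  rewrite EFinD leeD2r// EFinM; apply: lee_wpmul2l; first by rewrite lee_fin.
  by rewrite EFinD AE mE.
apply: (@le_trans _ _ ((c1 * A - c2 * m + c3)%:E + mus setT * (c1 + c2)%:E)%E).
  by rewrite -mE -EFinM -EFinD lee_fin; lra.
apply: leeD; first by rewrite -hE.
by apply: lee_wpmul2l => //; rewrite -mE lee_fin.
Qed.

(** * Height bound and Pinsker inequality *)

Theorem corollary6p3p13 (R : realType)
  (d : measure_display) (T : measurableType d)
  (T_nontrivial : exists A : set T,
     measurable A /\ A <> set0 /\ A <> [set: T])
  (phi : R -> \bar R)
  (phi_ge0 : forall x, (0 <= phi x)%E)
  (phi_convex : econvex phi)
  (phi_lsc : lower_semicontinuous phi)
  (phi1 : phi 1 = 0%E)
  (phi_neg : forall x, x < 0 -> phi x = +oo%E)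
  (phi_dom : nbhs (1 : R) (edom phi))
  (phi_strict : strictly_econvex phi)
  (phi_twice : forall x, (edom phi)° x ->
     derivable (phi_deriv phi 0) x 1 /\ derivable (phi_deriv phi 1) x 1)
  (phi_thrice : derivable (phi_deriv phi 2) (1 : R) 1)
  (phi2_gt0 : 0 < phi_deriv phi 2 1)
  (phi_ineq : forall z : R, -1 <= z -> (edom phi)° (1 + z) ->
     27 * phi_deriv phi 2 1
       / (3 - z * phi_deriv phi 3 1 / phi_deriv phi 2 1) ^+ 3
     <= phi_deriv phi 2 (1 + z)) :
  (forall t : R, 0 <= t ->
     (hgt (conjugate (shift1 phi)) t
      <= (t ^+ 2 / (8 * phi_deriv phi 2 1))%:E)%E)
  /\
  (forall mu nu : probability T R,
     ((phi_deriv phi 2 1 / 2)%:E * total_variation_distance mu nu ^+ 2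
      <= phi_divergence phi mu nu)%E).
Proof.
move: phi2_gt0 phi_ineq; set a := phi_deriv phi 2 1 => a0 ineq.
pose k := phi_deriv phi 3 1 / (3 * a).
have key s z :
    ((a / 2 * (2 * s * `|z| - s ^+ 2 * (1 - k * z)))%:E <= phi (1 + z)%R)%E.
  apply: (@phi_ge_tangent _ _ _ _ _ _ phi_ge0 phi_convex phi1 phi_dom phi_twice
    a0) => y domy ky.
  have y1 : -1 <= y.
    rewrite leNgt; apply/negP => y1.
    by have := interior_subset domy; rewrite /edom/= phi_neg//; lra.
  (* The 27 is the cube of the 3 factored out of the denominator. *)
  rewrite (_ : a / _ = 27 * a / (3 - y * phi_deriv phi 3 1 / a) ^+ 3).
    exact: ineq.
  have -> : 3 - y * phi_deriv phi 3 1 / a = 3 * (1 - k * y).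
    by rewrite /k; field; rewrite gt_eqF.
  by field; rewrite gt_eqF.
split=> [t t0|mu nu].
  apply: (@hgt_conjugate_le _ _ _ (t ^+ 2 * k / (8 * a))) => // z.
  rewrite /shift1 [z + 1]addrC.
  have := key (t / (2 * a)) z; congr (_%:E <= _)%E.
  by field; rewrite gt_eqF.
set V := total_variation_distance mu nu.
have Vfin : V \is a fin_num by exact: total_variation_distance_fin_num.
pose s := fine V.
have s0 : 0 <= s by rewrite fine_ge0// total_variation_distance_ge0.
have VE : (s%:E = V)%E by rewrite fineK.
(* These are the coefficients of the minorant in [key s]; the value [s = V] maximises
   [a (s V - s^2 / 2)]. *)
have := @phi_divergence_ge _ _ _ phi (a * s) (a / 2 * s ^+ 2 * k)
  (- (a / 2 * s ^+ 2)) mu nu.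
rewrite -/V -VE -EFin_expe -!EFinM -EFinD.
rewrite (_ : a * s * s - a / 2 * s ^+ 2 = a / 2 * s ^+ 2); last by field.
apply => //.
- exact: lower_semicontinuous_measurable.
- by rewrite mulr_ge0// ltW.
- move=> x; have := key s (x - 1); rewrite (_ : 1 + (x - 1) = x); last by ring.
  congr (_%:E <= _)%E.
  by field.
(* For [x >= 1] the absolute value opens and the minorant is [L x - M] with [L = c1 + c2] and
   [M = L - c3]. *)
- apply: (@recession_ge_slope _ _ _
    (a * s + a / 2 * s ^+ 2 * k + a / 2 * s ^+ 2)) => // x x1.
  have := key s (x - 1); rewrite (_ : 1 + (x - 1) = x); last by ring.
  congr (_%:E <= _)%E.
  rewrite ger0_norm; last lra.
  by field.
Qed.
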